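(* Let $N\ge1$ and consider the $1$-parameter family $\mathcal{X}_t:=\{f_t(\mathbf{x})=0\}$, $t\in\mathbb{C}$, with $$f_0(\mathbf{x}):=\sum_{i=1}^{N-1}x_i^2+x_N^3+x_{N+1}^5,$$ $$f_t(\mathbf{x}):=f_0(\mathbf{x})-27t^4x_Nx_{N+1}^2+54t^6x_{N+1}^3-6t\,x_Nx_{N+1}^3+18t^3x_{N+1}^4 .$$ Then, for generic $t\in\mathbb{C}$, $\mathcal{X}_t$ admits the unique singular point $\mathbf{0}\in f_t^{-1}(0)$, which is of type $D_7$.
   Context: $\mathbf{x}=(x_1,\ldots,x_{N+1})\in\mathbb{C}^{N+1}$. An isolated hypersurface singularity is of type $D_m$ ($m\ge4$) if it is equivalent, up to a local biholomorphic change of coordinates, to $\sum_{i=1}^{N-1}x_i^2+x_N^2x_{N+1}+x_{N+1}^{m-1}=0$ at the origin. *)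

(* Defs.v *)
From mathcomp Require Import all_boot all_order all_algebra.
From mathcomp Require Import complex.
From mathcomp Require Import all_classical all_reals all_analysis.

Set Implicit Arguments.
Unset Strict Implicit.
Unset Printing Implicit Defensive.
Import Order.TTheory GRing.Theory Num.Theory.
Import numFieldNormedType.Exports.
Local Open Scope ring_scope.
Local Open Scope classical_set_scope.
Local Open Scope complex_scope.

(* R[i] carries no normed-module structure under its own head symbol; naming
   it as a numClosedFieldType gives it the one induced by the modulus, so that
   [differentiable] below is complex (i.e. C-linear) Frechet differentiability. *)
Definition C (R : realType) : numClosedFieldType := R[i].

(* Coordinates are numbered from 1 to N.+1. *)
Definition crd (R : realType) (N : nat) (x : 'rV[C R]_N.+1) (k : nat) : C R :=
  x 0 (inord k.-1).

(* The property holds on a nonempty Zariski-open subset of the affine line. *)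
Definition generic (K : fieldType) (P : K -> Prop) : Prop :=
  exists q : {poly K}, q != 0 /\ forall t, q.[t] != 0 -> P t.

Section Singularities.
Context {R : realType} {n : nat}.
Implicit Types (f g : 'rV[C R]_n -> C R) (p : 'rV[C R]_n).

Definition holomorphic_on (W : normedModType (C R)) (U : set 'rV[C R]_n)
    (h : 'rV[C R]_n -> W) : Prop :=
  forall x, U x -> differentiable h x.

Definition biholomorphic (U V : set 'rV[C R]_n)
    (phi : 'rV[C R]_n -> 'rV[C R]_n) : Prop :=
  [/\ open U, open V, set_bij U V phi, holomorphic_on U phi &
      exists psi : 'rV[C R]_n -> 'rV[C R]_n,
        holomorphic_on V psi /\ forall x, U x -> psi (phi x) = x].

(* Equivalence of the hypersurface germs ({f = 0}, p) and ({g = 0}, q): a local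
   biholomorphism carries the ideal generated by g onto the one generated by f,
   i.e. identifies the two defining equations up to an invertible factor. *)
Definition germ_equivalent f p g (q : 'rV[C R]_n) : Prop :=
  exists (U V : set 'rV[C R]_n) (phi : 'rV[C R]_n -> 'rV[C R]_n)
         (u : 'rV[C R]_n -> C R),
    [/\ biholomorphic U V phi, U p /\ phi p = q,
        holomorphic_on U u, forall x, U x -> u x != 0 &
        forall x, U x -> f x = u x * g (phi x)].

(* [is_derive] also asserts that the partial derivatives exist. *)
Definition singular_point f p : Prop :=
  f p = 0 /\ forall i : 'I_n, is_derive p (delta_mx 0 i) f 0.

Definition isolated_singular_point f p : Prop :=
  singular_point f p /\ \forall x \near p, singular_point f x -> x = p.

End Singularities.

Definition D_normal_form (R : realType) (N m : nat) (x : 'rV[C R]_N.+1) : C R :=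
  \sum_(1 <= i < N) crd x i ^+ 2
  + crd x N ^+ 2 * crd x N.+1 + crd x N.+1 ^+ (m - 1).

Definition type_D (R : realType) (N m : nat) (f : 'rV[C R]_N.+1 -> C R)
    (p : 'rV[C R]_N.+1) : Prop :=
  [/\ (4 <= m)%N, isolated_singular_point f p &
      germ_equivalent f p (@D_normal_form R N m) 0].

Definition f0 (R : realType) (N : nat) (x : 'rV[C R]_N.+1) : C R :=
  \sum_(1 <= i < N) crd x i ^+ 2 + crd x N ^+ 3 + crd x N.+1 ^+ 5.

Definition ft (R : realType) (N : nat) (t : C R) (x : 'rV[C R]_N.+1) : C R :=
  f0 x - 27 * t ^+ 4 * crd x N * crd x N.+1 ^+ 2
  + 54 * t ^+ 6 * crd x N.+1 ^+ 3
  - 6 * t * crd x N * crd x N.+1 ^+ 3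
  + 18 * t ^+ 3 * crd x N.+1 ^+ 4.

(* Main.v *)
Require Import Defs.
From HB Require Import structures.
From mathcomp Require Import all_boot all_order all_algebra.
From mathcomp Require Import complex.
From mathcomp Require Import zify ring.
From mathcomp Require Import all_classical all_reals all_analysis.

(** Put v = x_(N+1), w = x_N - 3 t^2 v and s = 3 t w - v^2.  In these
coordinates the non-quadratic part of f_t is the plane curve
w^3 + v s^2 ([ft_plane]), which explains both halves of the statement.

Singular points.  The partial derivatives of w^3 + v s^2 in w and v are
3 w^2 + 6 t v s and s^2 - 4 v^2 s.  For t <> 0 the origin is the only point of
the curve where both vanish ([plane_singular]), and the derivatives along the
remaining axes are 2 x_i.  So t <> 0 is all that genericity has to provide.

Type D_7.  The curve is rational: k = s / w parametrises it by
v = k^2 (k - 3 t), w = - k^4 (k - 3 t).  The origin is attained at k = 3 t, a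
smooth branch, and at k = 0, a cusp.  Near k = 3 t the first equation defines k
as a holomorphic function of v ([smooth_branch_parameter]), and the smooth
branch is L = 0 with L = w + v k^2.  After completing the square in w, the other
factor is W^2 + E v^5 with E a unit.  Since L - W is v times a unit, this is
W^2 + F (L - W)^5 with F a unit ([plane_factor]).  Expanding the fifth power and
completing the square once more, in W, leaves A X0^2 + C L^5 with units A and C
([complete_square]); the linear term it removes is a multiple of L^4, so that
only terms of order at least 8 in L are added to the last summand.
Hence the curve is L (A X0^2 + C L^5), and with Y = (C / A) L and
X = (C / A)^2 X0 it becomes (A^6 / C^5) (X^2 Y + Y^6).  Multiplying each x_i by
C^2 sqrt(C) / A^3 makes the squares carry the same unit A^6 / C^5, which gives
the equivalence with the normal form ([germ_equivalent_ft]).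

That the resulting map is a local biholomorphism follows from the inverse
function theorem ([inverse_function]), which in dimension one also yields the
function k and the square root of C.  It is proved for maps that are strictly
differentiable at every point of a neighbourhood: strict differentiability is
what the contraction argument consumes, it is preserved by algebraic
operations, composition and inversion, and it implies differentiability. *)

Set Implicit Arguments.
Unset Strict Implicit.
Unset Printing Implicit Defensive.
Import Order.TTheory GRing.Theory Num.Theory.
Import numFieldNormedType.Exports.

Local Open Scope ring_scope.
Local Open Scope classical_set_scope.
Local Open Scope complex_scope.

(** * Strict differentiability *)

Section StrictDifferentiability.
Context {K : numFieldType}.
Implicit Types V W Z : normedModType K.

Lemma nbhs_distP V (p : V) (U : set V) :
  nbhs p U <-> exists2 r : K, 0 < r & forall x, `|x - p| < r -> U x.
Proof.
split=> [/nbhs_normP[r r0 rU]|[r r0 rU]].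
  by exists r => // x xr; apply: rU; rewrite /ball_ /= distrC.
by apply/nbhs_normP; exists r => // x; rewrite /ball_ /= distrC => /rU.
Qed.

(** Linearity and the bound are plain propositions on a bare function, so that
derivatives can be written as explicit formulas; the canonical linear structure
is only built in [strict_diff_is_diff]. *)
Definition bounded_linear V W (l : V -> W) :=
  linear l /\ exists2 k : K, 0 < k & forall v, `|l v| <= k * `|v|.

(** Both points of the difference quotient move: this is stronger than Frechet
differentiability at [p], and controls the Lipschitz constant of [f - l] near
[p]. *)
Definition strict_diff V W (f : V -> W) (p : V) (l : V -> W) :=
  bounded_linear l /\
  forall e : K, 0 < e -> exists2 U, nbhs p U & forall x y, U x -> U y ->
    `|f x - f y - l (x - y)| <= e * `|x - y|.

Definition strictly_diff V W (f : V -> W) (p : V) := exists l, strict_diff f p l.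

Section BoundedLinear.
Context {V W : normedModType K}.
Implicit Types l : V -> W.

Lemma bounded_linear0 l : bounded_linear l -> l 0 = 0.
Proof.
by case=> ll _; have := ll (-1) 0 0; rewrite scaleN1r oppr0 addr0 scaleN1r addNr.
Qed.

Lemma bounded_linearZ l a v : bounded_linear l -> l (a *: v) = a *: l v.
Proof.
move=> bl; have [ll _] := bl.
by have := ll a v 0; rewrite !addr0 (bounded_linear0 bl) addr0.
Qed.

Lemma bounded_linearD l u v : bounded_linear l -> l (u + v) = l u + l v.
Proof. by case=> ll _; have := ll 1 u v; rewrite !scale1r. Qed.

Lemma bounded_linearB l u v : bounded_linear l -> l (u - v) = l u - l v.
Proof.
by move=> bl; rewrite bounded_linearD// -scaleN1r bounded_linearZ// scaleN1r.
Qed.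

Lemma bounded_linear_eq l l' : l =1 l' -> bounded_linear l -> bounded_linear l'.
Proof. by move=> /funext ->. Qed.

Lemma bounded_linear_cst0 : bounded_linear (fun _ : V => 0 : W).
Proof.
split; first by move=> a u v; rewrite scaler0 addr0.
by exists 1 => // v; rewrite normr0 mul1r.
Qed.

Lemma bounded_linear_add l l' :
  bounded_linear l -> bounded_linear l' -> bounded_linear (fun v => l v + l' v).
Proof.
move=> bl bl'; split=> [a u v|].
  by rewrite !bounded_linearD// !bounded_linearZ// scalerDr addrACA.
case: bl bl' => _ [k k0 lk] [_ [k' k0' lk']]; exists (k + k'); first exact: addr_gt0.
by move=> v; rewrite mulrDl (le_trans (ler_normD _ _))// lerD.
Qed.

Lemma bounded_linear_scale a l :
  bounded_linear l -> bounded_linear (fun v => a *: l v).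
Proof.
move=> bl; split=> [b u v|].
  by rewrite bounded_linearD// bounded_linearZ// scalerDr !scalerA mulrC.
case: bl => _ [k k0 lk]; exists ((`|a| + 1) * k).
  by rewrite mulr_gt0// ltr_wpDl.
move=> v; rewrite normrZ -mulrA; apply: ler_pM => //.
by rewrite lerDl.
Qed.

End BoundedLinear.

Lemma bounded_linear_id V : bounded_linear (@idfun V).
Proof. by split=> //; exists 1 => // v; rewrite mul1r. Qed.

Lemma bounded_linear_comp V W Z (l : V -> W) (l' : W -> Z) :
  bounded_linear l -> bounded_linear l' -> bounded_linear (l' \o l).
Proof.
move=> bl bl'; split=> [a u v|] /=.
  by rewrite !bounded_linearD// !bounded_linearZ.
case: bl bl' => _ [k k0 lk] [_ [k' k0' lk']]; exists (k' * k); first exact: mulr_gt0.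
by move=> v /=; rewrite (le_trans (lk' _))// -mulrA ler_wpM2l// ltW.
Qed.

Section Rules.
Context {V W : normedModType K}.
Implicit Types (f g : V -> W) (p : V).

Lemma strict_diff_eq f f' p l l' :
  strict_diff f p l -> f =1 f' -> l =1 l' -> strict_diff f' p l'.
Proof. by move=> + /funext <- /funext <-. Qed.

Lemma strict_diff_linear (l : V -> W) p : bounded_linear l -> strict_diff l p l.
Proof.
move=> bl; split=> // e e0; exists setT; first exact: filterT.
by move=> x y _ _; rewrite -bounded_linearB// subrr normr0 mulr_ge0// ltW.
Qed.

Lemma strict_diff_cst c p : strict_diff (fun _ : V => c : W) p (fun=> 0).
Proof.
split=> [|e e0]; first exact: bounded_linear_cst0.
exists setT; first exact: filterT.
by move=> x y _ _; rewrite !subrr normr0 mulr_ge0// ltW.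
Qed.

Lemma strict_diffD f g p l m : strict_diff f p l -> strict_diff g p m ->
  strict_diff (fun x => f x + g x) p (fun v => l v + m v).
Proof.
move=> [bl fl] [bm gm]; split; first exact: bounded_linear_add.
move=> e e0; have e2 : 0 < e / 2 by rewrite divr_gt0.
have [U pU Ul] := fl _ e2; have [U' pU' Um] := gm _ e2.
exists (U `&` U'); first exact: filterI.
move=> x y [Ux U'x] [Uy U'y].
rewrite [e](splitr e) mulrDl !opprD (addrACA (f x) _ (- f y)) (addrACA (f x - f y)).
rewrite (le_trans (ler_normD _ _))// lerD//; [exact: Ul|exact: Um].
Qed.

Lemma strict_diff_lipschitz f p l : strict_diff f p l ->
  exists2 k : K, 0 < k & exists2 U, nbhs p U & forall x y, U x -> U y ->
    `|f x - f y| <= k * `|x - y|.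
Proof.
move=> [[_ [k k0 lk]] /(_ 1 ltr01)[U pU Ul]].
exists (1 + k); first by rewrite ltr_wpDr// ltW.
exists U => // x y Ux Uy; rewrite mulrDl -(subrK (l (x - y)) (f x - f y)).
exact: le_trans (ler_normD _ _) (lerD (Ul _ _ Ux Uy) (lk _)).
Qed.

Lemma strict_diff_nbhs f p l (A : set W) :
  strict_diff f p l -> nbhs (f p) A -> nbhs p (f @^-1` A).
Proof.
move=> /strict_diff_lipschitz[k k0 [U pU Uk]] /nbhs_distP[r r0 rA].
have /filterI : nbhs p [set x | `|x - p| < r / k].
  by apply/nbhs_distP; exists (r / k); rewrite ?divr_gt0.
move=> /(_ _ pU); apply: filterS => x [/= xr Ux]; apply: rA.
apply: le_lt_trans (Uk x p Ux (nbhs_singleton pU)) _.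
by rewrite mulrC -ltr_pdivlMr.
Qed.

(** Fixing the second point at [p] in the strict estimate gives the Frechet
one. *)
Lemma strict_diff_is_diff f p l : strict_diff f p l -> is_diff p f l.
Proof.
move=> [bl fl]; have [ll [k k0 lk]] := bl.
pose lM := GRing.isLinear.Build _ _ _ _ _ ll.
pose L : {linear V -> W} := HB.pack l lM.
have cL : continuous L.
  move=> x; apply/cvgrPdist_le => e e0; apply/nbhs_distP.
  exists (e / k); rewrite ?divr_gt0// => y yx.
  rewrite -[L x - L y]linearB (le_trans (lk _))// mulrC -ler_pdivlMr//.
  by rewrite distrC ltW.
have E : f \o shift p = cst (f p) + L +o_ 0 id.
  apply/eqaddoP => e e0; have [U pU Ul] := fl _ e0.
  have : nbhs (0 : V) [set y | U (y + p)].
    move/nbhs_distP: pU => [r r0 rU]; apply/nbhs_distP; exists r => // y.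
    by rewrite subr0 => yr; apply: rU; rewrite addrK.
  apply: filterS => y /= Uy; have := Ul _ _ Uy (nbhs_singleton pU).
  by rewrite addrK !fctE opprD addrA.
apply: DiffDef; last by rewrite (diff_unique cL E).
by apply/diff_locallyP; rewrite (diff_unique cL E).
Qed.

Lemma strict_diff_is_derive f p l v : strict_diff f p l -> is_derive p v f (l v).
Proof.
move=> /strict_diff_is_diff[df dl]; split; first exact: diff_derivable.
by rewrite deriveE// dl.
Qed.

End Rules.

Lemma strict_diff_comp V W Z (f : V -> W) (g : W -> Z) p l m :
  strict_diff f p l -> strict_diff g (f p) m ->
  strict_diff (g \o f) p (m \o l).
Proof.
move=> sf sg; have [bl fl] := sf; have [bm gm] := sg.
split; first exact: bounded_linear_comp.
move=> e e0; have [kf kf0 [U0 pU0 U0f]] := strict_diff_lipschitz sf.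
have [_ [km km0 mk]] := bm.
have e1 : 0 < e / 2 / kf by rewrite !divr_gt0.
have e2 : 0 < e / 2 / km by rewrite !divr_gt0.
have [A pA Am] := gm _ e1; have [U pU Ul] := fl _ e2.
exists ((f @^-1` A) `&` (U0 `&` U)).
  by apply: filterI; [exact: strict_diff_nbhs sf pA|exact: filterI].
move=> x y [Ax [U0x Ux]] [Ay [U0y Uy]] /=.
rewrite -[_ - _ - _](subrKA (m (f x - f y))) -(bounded_linearB _ _ bm).
rewrite (le_trans (ler_normD _ _))// [e](splitr e) mulrDl lerD//.
  rewrite (le_trans (Am _ _ Ax Ay))// -ler_pdivlMl// mulrA (le_trans (U0f _ _ U0x U0y))//.
  by rewrite invf_div divfK ?gt_eqF ?divr_gt0.
rewrite (le_trans (mk _))// mulrC -ler_pdivlMr//.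
by rewrite (le_trans (Ul _ _ Ux Uy))// mulrAC.
Qed.

End StrictDifferentiability.

Section ScalarRules.
Context {K : numFieldType} {V : normedModType K}.
Implicit Types (f g : V -> K) (p : V).

Lemma strict_diffM f g p l m : strict_diff f p l -> strict_diff g p m ->
  strict_diff (fun x => f x * g x) p (fun v => g p * l v + f p * m v).
Proof.
move=> sf sg; have [bl fl] := sf; have [bm gm] := sg; split.
  exact: bounded_linear_add (bounded_linear_scale _ bl) (bounded_linear_scale _ bm).
move=> e e0.
have [kf kf0 [U0 pU0 U0f]] := strict_diff_lipschitz sf.
have [kg kg0 [U1 pU1 U1g]] := strict_diff_lipschitz sg.
have e4 : 0 < e / 4 by rewrite divr_gt0.
have ef : 0 < e / 4 / (`|f p| + 1) by rewrite divr_gt0// ltr_wpDl.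
have eg : 0 < e / 4 / (`|g p| + 1) by rewrite divr_gt0// ltr_wpDl.
have [U2 pU2 U2f] := fl _ eg; have [U3 pU3 U3g] := gm _ ef.
have pA : nbhs p [set x | `|f x - f p| < e / 4 / kg].
  apply: (strict_diff_nbhs (A := [set y | `|y - f p| < e / 4 / kg]) sf).
  by apply/nbhs_distP; exists (e / 4 / kg); rewrite ?divr_gt0.
have pB : nbhs p [set x | `|g x - g p| < e / 4 / kf].
  apply: (strict_diff_nbhs (A := [set y | `|y - g p| < e / 4 / kf]) sg).
  by apply/nbhs_distP; exists (e / 4 / kf); rewrite ?divr_gt0.
exists (U0 `&` U1 `&` (U2 `&` U3) `&`
  ([set x | `|f x - f p| < e / 4 / kg] `&` [set x | `|g x - g p| < e / 4 / kf])).
  by do !apply: filterI.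
move=> x y [[[U0x U1x] [U2x U3x]] [/= Ax Bx]] [[[U0y U1y] [U2y U3y]] [/= Ay By]].
(* Four error terms; each is made at most a quarter of the allowed error. *)
have -> : f x * g x - f y * g y - (g p * l (x - y) + f p * m (x - y)) =
    ((f x - f p) * (g x - g y) + (g y - g p) * (f x - f y)) +
    (f p * (g x - g y - m (x - y)) + g p * (f x - f y - l (x - y))) by ring.
have -> : e * `|x - y| = (e / 4 * `|x - y| + e / 4 * `|x - y|) +
    (e / 4 * `|x - y| + e / 4 * `|x - y|) by field.
have bnd k d z : 0 < k -> `|d| <= e / 4 / k -> `|z| <= k * `|x - y| ->
    `|d * z| <= e / 4 * `|x - y|.
  move=> k0 dk zk; rewrite normrM (le_trans (ler_pM _ _ dk zk))//.
  by rewrite mulrA divfK ?gt_eqF.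
have bnd' c z : `|z| <= e / 4 / (`|c| + 1) * `|x - y| ->
    `|c * z| <= e / 4 * `|x - y|.
  move=> zk; have c1 : 0 < `|c| + 1 by rewrite ltr_wpDl.
  rewrite normrM (le_trans (ler_pM _ _ (lexx _) zk))//.
  rewrite mulrA ler_wpM2r// mulrC -[leRHS]mulr1 -[_ / (_ + _) * _]mulrA.
  by rewrite ler_wpM2l ?(ltW e4)// mulrC ler_pdivrMr// mul1r lerDl.
rewrite (le_trans (ler_normD _ _))// lerD// (le_trans (ler_normD _ _))// lerD//.
- exact: bnd kg0 (ltW Ax) (U1g _ _ U1x U1y).
- exact: bnd kf0 (ltW By) (U0f _ _ U0x U0y).
- exact/bnd'/U3g.
- exact/bnd'/U2f.
Qed.

Lemma strict_diffX f p l n : strict_diff f p l ->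
  strict_diff (fun x => f x ^+ n) p (fun v => n%:R * f p ^+ n.-1 * l v).
Proof.
move=> sf; elim: n => [|n IH].
  apply: (strict_diff_eq (strict_diff_cst (1 : K) p)) => v; first by rewrite expr0.
  by rewrite !mul0r.
apply: (strict_diff_eq (strict_diffM sf IH)) => v; first by rewrite exprS.
by case: n {IH} => [|n] /=; rewrite ?mul0r ?mulr0 ?addr0 ?expr0 ?exprS; ring.
Qed.

End ScalarRules.

Lemma nbhs_neq0 {K : numFieldType} (a : K) : a != 0 -> nbhs a [set x | x != 0].
Proof.
move=> a0; apply/nbhs_distP; exists `|a|; first by rewrite normr_gt0.
by move=> x /=; apply: contraTneq => ->; rewrite sub0r normrN ltxx.
Qed.

(** From x^-1 - y^-1 + a^-2 (x - y)
= (a^-1 (a^-1 - y^-1) + (a^-1 - x^-1) y^-1) (x - y): the first factor is small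
as soon as x^-1 and y^-1 are close to a^-1. *)
Lemma strict_diff_inv {K : numFieldType} (a : K) : a != 0 ->
  strict_diff (fun x : K => x^-1) a (fun v => - (a ^- 2) * v).
Proof.
move=> a0; split.
  apply: (bounded_linear_scale (V := K) (W := K) (- (a ^- 2)) (l := id)).
  by split=> //; exists 1 => // v; rewrite mul1r.
move=> e e0; pose b := `|a^-1|.
have b0 : 0 < b by rewrite normr_gt0 invr_neq0.
have d0 : 0 < e / (e + 2 * b + 1).
  by rewrite divr_gt0// ltr_wpDl// addr_ge0 ?mulr_ge0 ?ltW.
set d := _ / _ in d0.
have d1 : d <= 1.
  rewrite ler_pdivrMr ?mul1r; last by rewrite ltr_wpDl// addr_ge0 ?mulr_ge0 ?ltW.
  by rewrite -addrA lerDl addr_ge0 ?mulr_ge0// ltW.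
have dE : d * (2 * b + 1) <= e.
  rewrite /d mulrAC ler_pdivrMr; last by rewrite ltr_wpDl// addr_ge0 ?mulr_ge0 ?ltW.
  by rewrite ler_wpM2l ?(ltW e0)// -addrA lerDr ltW.
(* d is at most 1 and d (2 b + 1) <= e bounds the first factor above. *)
exists [set x | x != 0 /\ `|a^-1 - x^-1| <= d].
  apply: filterI; first exact: nbhs_neq0.
  have := inv_continuous a0; move/cvgrPdist_le; exact.
move=> x y [x0 xd] [y0 yd].
have -> : x^-1 - y^-1 - - a ^- 2 * (x - y) =
    (a^-1 * (a^-1 - y^-1) + (a^-1 - x^-1) * y^-1) * (x - y).
  by field; rewrite a0 x0 y0.
rewrite normrM ler_wpM2r// (le_trans _ dE)//.
have -> : d * (2 * b + 1) = b * d + d * (b + 1) by ring.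
rewrite (le_trans (ler_normD _ _))// !normrM lerD//; first by rewrite ler_wpM2l.
rewrite -[y^-1](subKr a^-1).
have yb : `|a^-1 - (a^-1 - y^-1)| <= b + 1.
  by rewrite (le_trans (ler_normB _ _))// lerD// (le_trans yd).
exact: ler_pM.
Qed.

Lemma strict_diffV {K : numFieldType} {V : normedModType K} (f : V -> K) p l :
  f p != 0 -> strict_diff f p l ->
  strict_diff (fun x => (f x)^-1) p (fun v => - (f p ^- 2) * l v).
Proof. by move=> fp sf; exact: strict_diff_comp sf (strict_diff_inv fp). Qed.

Section StrictlyDiff.
Context {K : numFieldType} {V : normedModType K}.
Implicit Types (f g : V -> K) (p : V).

Lemma strictly_diff_cst (c : K) p : strictly_diff (fun _ : V => c) p.
Proof. by exists (fun=> 0); exact: strict_diff_cst. Qed.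

Lemma strictly_diffD f g p :
  strictly_diff f p -> strictly_diff g p -> strictly_diff (fun x => f x + g x) p.
Proof. by move=> [l fl] [m gm]; eexists; exact: strict_diffD fl gm. Qed.

Lemma strictly_diffM f g p :
  strictly_diff f p -> strictly_diff g p -> strictly_diff (fun x => f x * g x) p.
Proof. by move=> [l fl] [m gm]; eexists; exact: strict_diffM fl gm. Qed.

Lemma strictly_diffN f p : strictly_diff f p -> strictly_diff (fun x => - f x) p.
Proof.
move=> fp; have := strictly_diffM (strictly_diff_cst (-1) p) fp.
by congr strictly_diff; apply/funext => x; rewrite mulN1r.
Qed.

Lemma strictly_diffX f p n : strictly_diff f p -> strictly_diff (fun x => f x ^+ n) p.
Proof. by move=> [l fl]; eexists; exact: strict_diffX fl. Qed.

Lemma strictly_diffV f p :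
  f p != 0 -> strictly_diff f p -> strictly_diff (fun x => (f x)^-1) p.
Proof. by move=> fp [l fl]; eexists; exact: strict_diffV fp fl. Qed.

Lemma strictly_diff_comp (W Z : normedModType K) (f : V -> W) (g : W -> Z) p :
  strictly_diff f p -> strictly_diff g (f p) -> strictly_diff (fun x => g (f x)) p.
Proof. by move=> [l fl] [m gm]; eexists; exact: strict_diff_comp fl gm. Qed.

Lemma strictly_diff_nbhs (W : normedModType K) (f : V -> W) p (A : set W) :
  strictly_diff f p -> nbhs (f p) A -> nbhs p (f @^-1` A).
Proof. by move=> [l fl]; exact: strict_diff_nbhs fl. Qed.

Lemma strictly_diff_differentiable (W : normedModType K) (f : V -> W) p :
  strictly_diff f p -> differentiable f p.
Proof. by move=> [l /strict_diff_is_diff[]]. Qed.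

(** Products with a factor vanishing at [p] are all that the linear part of the
coordinate change needs; the derivative of the other factor disappears. *)
Lemma strict_diffMv f g p m : strictly_diff f p -> g p = 0 ->
  strict_diff g p m -> strict_diff (fun x => f x * g x) p (fun v => f p * m v).
Proof.
move=> [l fl] gp gm; apply: (strict_diff_eq (strict_diffM fl gm)) => // v.
by rewrite gp mul0r add0r.
Qed.

Lemma strict_diffB f g p l m : strict_diff f p l -> strict_diff g p m ->
  strict_diff (fun x => f x - g x) p (fun v => l v - m v).
Proof.
move=> fl gm.
have gN := strict_diff_comp gm (strict_diff_linear (g p)
  (bounded_linear_scale (-1) (bounded_linear_id K))).
apply: (strict_diff_eq (strict_diffD fl gN)) => v /=; by rewrite scaleN1r.
Qed.

End StrictlyDiff.

Section RowVectors.
Context {K : numFieldType}.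

Lemma bounded_linear_scalel (V : normedModType K) (w : V) :
  bounded_linear (fun c : K => c *: w).
Proof.
split=> [a c d|]; first by rewrite scalerDl scalerA.
exists (`|w| + 1) => [|c]; first by rewrite ltr_wpDl.
by rewrite normrZ mulrC ler_wpM2r// lerDl.
Qed.

Lemma bounded_linear_coord n (j : 'I_n) :
  bounded_linear (fun x : 'rV[K]_n => x 0 j).
Proof.
have ll : linear (fun x : 'rV[K]_n => x 0 j) by move=> a x y; rewrite !mxE.
pose lM := GRing.isLinear.Build _ _ _ _ _ ll.
pose L : {linear 'rV[K]_n -> K} := HB.pack (fun x : 'rV[K]_n => x 0 j) lM.
by split=> //; apply: (linear_lipschitz (f := L)); exact: coord_continuous.
Qed.

Lemma strict_diff_sum (V W : normedModType K) (I : Type) (s : seq I)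
    (f l : I -> V -> W) p :
  (forall i, strict_diff (f i) p (l i)) ->
  strict_diff (fun x => \sum_(i <- s) f i x) p (fun v => \sum_(i <- s) l i v).
Proof.
move=> fl; elim: s => [|i s IH].
  by apply: (strict_diff_eq (strict_diff_cst (0 : W) p)) => v; rewrite big_nil.
by apply: (strict_diff_eq (strict_diffD (fl i) IH)) => v; rewrite big_cons.
Qed.

Lemma row_delta n (c : 'I_n -> K) :
  \row_j c j = \sum_j c j *: delta_mx 0 j :> 'rV[K]_n.
Proof. by rewrite [LHS]row_sum_delta; apply: eq_bigr => j _; rewrite mxE. Qed.

Lemma strict_diff_row (V : normedModType K) n (f l : 'I_n -> V -> K) p :
  (forall j, strict_diff (f j) p (l j)) ->
  strict_diff (fun x => \row_j f j x) p (fun v => \row_j l j v).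
Proof.
move=> fl.
have fd j : strict_diff (fun x => f j x *: (delta_mx 0 j : 'rV[K]_n)) p
    (fun v => l j v *: delta_mx 0 j).
  exact: strict_diff_comp (fl j) (strict_diff_linear _ (bounded_linear_scalel _)).
by apply: (strict_diff_eq (strict_diff_sum _ fd)) => v; rewrite row_delta.
Qed.

End RowVectors.

Lemma strictly_diff_row (K : numFieldType) (V : normedModType K) n
    (f : 'I_n -> V -> K) p :
  (forall j, strictly_diff (f j) p) -> strictly_diff (fun x => \row_j f j x) p.
Proof.
move=> fd; exists (fun v => \row_j sval (cid (fd j)) v).
by apply: strict_diff_row => j; case: cid.
Qed.

Lemma bounded_linear_row (K : numFieldType) (V : normedModType K) n
    (l : 'I_n -> V -> K) :
  (forall j, bounded_linear (l j)) -> bounded_linear (fun v => \row_j l j v).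
Proof.
by move=> bl; have [] := strict_diff_row (fun j => strict_diff_linear 0 (bl j)).
Qed.

(** * Completeness of the complex plane *)

Section ComplexComplete.
Variable R : realType.

Lemma normc_ge_Im (z : C R) : (`|complex.Im z|)%:C <= `|z|.
Proof.
by rewrite normc_def lecE/= eqxx/= -sqrtr_sqr ler_wsqrtr// lerDr sqr_ge0.
Qed.

Lemma normc_real (x : R) : `|x%:C : C R| = `|x|%:C.
Proof. by rewrite normc_def/= expr0n/= addr0 sqrtr_sqr. Qed.

Lemma normc_i : `|'i%C : C R| = 1.
Proof. by rewrite normc_def/= expr0n/= add0r expr1n sqrtr1. Qed.

(** Applied to the real and imaginary parts, it reduces the completeness of the
complex plane to that of the real line. *)
Lemma complex_cauchy (g : C R -> R) (F : set_system (C R)) :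
  (forall x y, (`|g x - g y|)%:C <= `|x - y|) -> ProperFilter F ->
  cauchy F -> cvg (g @ F).
Proof.
move=> gl FF /cauchy_ballP Fc; apply: cauchy_cvg.
apply/cauchy_ballP => e e0; rewrite near_map2.
have e0' : 0 < e%:C by rewrite ltcR.
apply: filterS (Fc _ e0') => -[x y] /=; rewrite -!ball_normE/= => xy.
by rewrite -ltcR (le_lt_trans (gl _ _)).
Qed.

Lemma C_complete (F : set_system (C R)) : ProperFilter F -> cauchy F -> cvg F.
Proof.
move=> FF Fc.
have cRe : cvg (@complex.Re R @ F).
  by apply: complex_cauchy => // x y; rewrite -raddfB; exact: normc_ge_Re.
have cIm : cvg (@complex.Im R @ F).
  by apply: complex_cauchy => // x y; rewrite -raddfB; exact: normc_ge_Im.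
set a := lim (@complex.Re R @ F) in cRe; set b := lim (@complex.Im R @ F) in cIm.
apply/cvg_ex; exists ((a +i* b) : C R); apply/cvgrPdist_le => e e0.
have e2 : 0 < complex.Re e / 2 by rewrite divr_gt0//; move: e0; rewrite ltcE => /andP[].
have eE : e = (complex.Re e / 2)%:C + (complex.Re e / 2)%:C.
  rewrite -rmorphD -splitr; move: e0; rewrite ltcE/= => /andP[/eqP ie _].
  by rewrite [LHS]complexE ie mulr0 addr0.
move/cvgrPdist_le : cRe => /(_ _ e2) cRe; move/cvgrPdist_le : cIm => /(_ _ e2) cIm.
apply: filterS2 cRe cIm => z za zb.
rewrite [X in `|X|]complexE (le_trans (ler_normD _ _))// eE lerD//.
  by rewrite normc_real lecR raddfB.
by rewrite normrM normc_i mul1r normc_real lecR raddfB.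
Qed.

End ComplexComplete.
HB.instance Definition _ (R : realType) :=
  Uniform_isComplete.Build (C R) (@C_complete R).
HB.instance Definition _ (R : realType) m n :=
  Uniform_isComplete.Build 'M[C R]_(m, n) (@cauchy_cvg 'M[C R]_(m, n)).

(** * The inverse function theorem *)

Section InverseFunction.
Variables (R : realType) (V : completeNormedModType (C R)).

Lemma half_pow_lt (e : C R) : 0 < e -> exists n, 2 ^- n < e.
Proof.
rewrite ltcE => /andP[/= /eqP ie re]; pose n := Num.bound (complex.Re e)^-1.
exists n; rewrite invf_plt ?posrE ?exprn_gt0//; last by rewrite ltcE/= ie eqxx.
have -> : e = (complex.Re e)%:C by rewrite [LHS]complexE ie mulr0 addr0.
rewrite -fmorphV -(rmorph_nat (real_complex R)) -rmorphXn ltcR/=.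
have ge0 : 0 <= (complex.Re e)^-1 by rewrite invr_ge0 ltW.
rewrite (lt_trans (archi_boundP ge0))// -natrX ltr_nat.
by rewrite -/n ltn_expl.
Qed.

(** The iterates of x |-> x - G x + z from [p] have increments bounded by
r / 2, r / 4, r / 8, ..., so they stay within [r] of [p] and converge to a
solution.  The estimate is assumed on the ball of radius 2 r, where the limit
is seen to lie without taking limits in the inequalities. *)
Lemma near_identity_surj (G : V -> V) (p z : V) (r : C R) : 0 < r ->
  (forall x y, `|x - p| <= 2 * r -> `|y - p| <= 2 * r ->
     `|G x - G y - (x - y)| <= 2^-1 * `|x - y|) ->
  `|z - G p| <= r / 2 -> exists2 x, `|x - p| <= 2 * r & G x = z.
Proof.
move=> r0 GL zp; pose u n := iter n (fun x => x - G x + z) p.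
have uS n : u n.+1 = u n - G (u n) + z by [].
have h n : 0 < 2 ^- n :> C R by rewrite invr_gt0 exprn_gt0.
have hS n : 2 ^- n.+1 = 2^-1 * 2 ^- n :> C R by rewrite exprS invfM.
have ub n : `|u n - p| <= r * (1 - 2 ^- n) /\ `|u n.+1 - u n| <= r / 2 * 2 ^- n.
  elim: n => [|n [IH1 IH2]].
    rewrite uS /u /= subrr normr0 expr0 invr1 subrr mulr0 mulr1; split=> //.
    by rewrite addrAC [X in X + z]addrAC subrr add0r addrC.
  have un1 : `|u n.+1 - p| <= r * (1 - 2 ^- n.+1).
    rewrite -(subrKA (u n)) (le_trans (ler_normD _ _))//.
    rewrite (le_trans (lerD IH2 IH1))// hS le_eqVlt; apply/orP; left.
    by apply/eqP; field.
  split=> //; have le2 m : `|u m - p| <= r * (1 - 2 ^- m) -> `|u m - p| <= 2 * r.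
    move=> /le_trans; apply; rewrite mulrC ler_wpM2r ?(ltW r0)// lerBlDr.
    by rewrite (@ltW _ _ 1)// -[ltLHS]addr0 ler_ltD// ler1n.
  have aux (a b c d : V) : (a - b + z) - (c - d + z) = (a - c) - (b - d).
    by rewrite [- (c - d + z)]opprD addrACA subrr addr0 !opprB [d - c]addrC addrACA
      [- b + d]addrC.
  have -> : u n.+2 - u n.+1 = (u n.+1 - u n) - (G (u n.+1) - G (u n)).
    exact: aux.
  rewrite distrC (le_trans (GL _ _ (le2 _ un1) (le2 _ IH1)))//.
  by rewrite hS mulrCA ler_wpM2l ?invr_ge0.
have ud n m : `|u (n + m)%N - u n| <= r * 2 ^- n.
  suff : `|u (n + m)%N - u n| <= r * 2 ^- n * (1 - 2 ^- m).
    move=> /le_trans; apply; rewrite -[leRHS]mulr1 ler_wpM2l ?mulr_ge0 ?(ltW r0) ?(ltW (h n))// lerBlDr lerDl ltW.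
  elim: m => [|m IH]; first by rewrite addn0 subrr normr0 expr0 invr1 subrr mulr0.
  rewrite addnS -(subrKA (u (n + m)%N)) (le_trans (ler_normD _ _))//.
  have [_ IH2] := ub (n + m)%N.
  rewrite (le_trans (lerD IH2 IH))// hS exprD invfM le_eqVlt; apply/orP; left.
  by apply/eqP; field; rewrite !expf_neq0.
have ucvg : cvg (u n @[n --> \oo]).
  apply: cauchy_cvg; apply/cauchy_ballP => e e0.
  have [N Ne] : exists N, 2 ^- N < e / (2 * r).
    by apply: half_pow_lt; rewrite divr_gt0// mulr_gt0.
  rewrite near_map2; exists ([set n | (N <= n)%N], [set n | (N <= n)%N]) => /=.
    by split; exists N.
  move=> [n m] [/= Nn Nm]; rewrite -ball_normE /=.
  rewrite -(subrKA (u N)) (le_lt_trans (ler_normD _ _))// [X in _ + X]distrC.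
  have dN k : (N <= k)%N -> `|u k - u N| <= r * 2 ^- N by move/subnKC => <-.
  rewrite (le_lt_trans (lerD (dN _ Nn) (dN _ Nm)))//.
  move: Ne; rewrite ltr_pdivlMr ?mulr_gt0//; congr (_ < _); ring.
have /cvg_ex[x ux] := ucvg.
have nx e : 0 < e -> exists n, `|x - u n| <= e /\ `|x - u n.+1| <= e.
  move=> e0; move/cvgrPdist_le : ux => /(_ _ e0)[N _ uN].
  by exists N; split; apply: uN => //=; exact: leqnSn.
have le2 m : `|u m - p| <= 2 * r.
  have [+ _] := ub m; move=> /le_trans; apply; rewrite mulrC ler_wpM2r ?(ltW r0)// lerBlDr.
  by rewrite (@ltW _ _ 1)// -[ltLHS]addr0 ler_ltD// ler1n.
have xp : `|x - p| <= 2 * r.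
  have [n [xn _]] := nx _ r0; have [un _] := ub n.
  rewrite -(subrKA (u n)) (le_trans (ler_normD _ _))// mulr_natl mulr2n lerD//.
  by rewrite (le_trans un)// ger_pMr// lerBlDr lerDl ltW.
exists x => //; apply/eqP; rewrite -subr_eq0 -normr_eq0; apply/negPn/negP => nz.
have a0 : 0 < `|G x - z| by rewrite lt_def nz normr_ge0.
have [n [xn xn1]] := nx _ (divr_gt0 a0 (ltr0n _ 8)).
have Gn : `|G x - G (u n)| <= 2^-1 * `|x - u n| + `|x - u n|.
  rewrite -[G x - _](subrK (x - u n)) (le_trans (ler_normD _ _))// lerD//.
  exact: GL.
have Gu : G (u n) - z = u n - u n.+1 by rewrite uS opprD opprB addrA addrCA subrr addr0.
have : `|G x - z| <= (2^-1 * (`|G x - z| / 8) + `|G x - z| / 8) +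
    (`|G x - z| / 8 + `|G x - z| / 8).
  rewrite -{1}(subrKA (G (u n))) (le_trans (ler_normD _ _))// lerD//.
    by rewrite (le_trans Gn)// lerD// ler_wpM2l// invr_ge0.
  by rewrite Gu -(subrKA x) (le_trans (ler_normD _ _))// lerD// distrC.
have -> : (2^-1 * (`|G x - z| / 8) + `|G x - z| / 8) +
    (`|G x - z| / 8 + `|G x - z| / 8) = `|G x - z| - 9 / 16 * `|G x - z| by field.
have c0 : 0 < 9 / 16 * `|G x - z| by rewrite mulr_gt0// divr_gt0.
by rewrite lerBrDr gerDl => /(lt_le_trans c0); rewrite ltxx.
Qed.

(** For a linear map the estimate of [near_identity_surj] holds on balls of any
radius, hence surjectivity. *)
Lemma near_identity_linear (m : V -> V) :
  bounded_linear m -> (forall v, `|m v - v| <= 2^-1 * `|v|) ->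
  exists2 m', bounded_linear m' & cancel m m' /\ cancel m' m.
Proof.
move=> bm mv.
have half (a : C R) : a - 2^-1 * a = 2^-1 * a by field.
have lower v : `|v| <= 2 * `|m v|.
  have : `|v| - `|m v| <= 2^-1 * `|v|.
    by rewrite (le_trans _ (mv v))// distrC lerB_dist.
  by rewrite lerBlDl -lerBlDr half ler_pdivrMl.
have surj z : exists x, m x = z.
  have [->|z0] := eqVneq z 0; first by exists 0; rewrite bounded_linear0.
  have [|x y _ _||x _ mx] := near_identity_surj (G := m) (p := 0) (z := z) (r := 2 * `|z|).
  - by rewrite mulr_gt0// normr_gt0.
  - by rewrite -(bounded_linearB _ _ bm).
  - by rewrite bounded_linear0// subr0 mulrAC divff// mul1r.
  - by exists x.
pose m' z := xget 0 [set x | m x = z].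
have m'K : cancel m' m by move=> z; rewrite /m'; exact: (xgetPex 0 (surj z)).
have mK : cancel m m'.
  move=> x; apply/eqP; rewrite -subr_eq0 -normr_le0 (le_trans (lower _))//.
  by rewrite bounded_linearB// m'K subrr normr0 mulr0.
exists m' => //; split=> [a u v|].
  apply: (can_inj mK); rewrite m'K bounded_linearD// bounded_linearZ// !m'K.
  by [].
by exists 2 => // v; rewrite (le_trans (lower _))// m'K.
Qed.

(** A Lipschitz right inverse [g] of [f] is strictly differentiable because
g z - g z' - l' (z - z') is the image under - l' of the strict error of [f]. *)
Lemma strict_diff_inverse (f g : V -> V) (y : V) l l' (k : C R) (A : set V) :
  strict_diff f (g y) l -> bounded_linear l' -> cancel l l' ->
  nbhs y A -> (forall z, A z -> f (g z) = z) -> 0 < k ->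
  (forall z z', A z -> A z' -> `|g z - g z'| <= k * `|z - z'|) ->
  strict_diff g y l'.
Proof.
move=> [_ fl] bl' ll' yA fg k0 gk; split=> // e e0.
have [_ [k' k'0 l'k]] := bl'.
have e1 : 0 < e / k / k' by rewrite !divr_gt0.
have [B yB Bl] := fl _ e1.
have /filterI : nbhs y (g @^-1` B).
  move/nbhs_distP : yB => [s s0 sB].
  have yk : nbhs y [set z | `|z - y| < s / k].
    by apply/nbhs_distP; exists (s / k); rewrite ?divr_gt0.
  apply: (filterS2 _ _ yA yk) => z Az /= zs.
  apply: sB; apply: le_lt_trans (gk _ _ Az (nbhs_singleton yA)) _.
  by rewrite mulrC -ltr_pdivlMr.
move=> /(_ _ yA) yAB; exists (g @^-1` B `&` A) => // z z' [/= Bz Az] [/= Bz' Az'].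
have -> : g z - g z' - l' (z - z') = - l' (f (g z) - f (g z') - l (g z - g z')).
  by rewrite (bounded_linearB _ (l _) bl') ll' opprB !fg.
rewrite normrN (le_trans (l'k _))// -ler_pdivlMl// (le_trans (Bl _ _ Bz Bz'))//.
rewrite -ler_pdivlMl// (le_trans (gk _ _ Az Az'))//.
rewrite le_eqVlt; apply/orP; left; apply/eqP; field.
by rewrite !gt_eqF.
Qed.

(** Composing with the inverse [T] of the derivative brings [f] near the
identity, where [near_identity_surj] applies.  On the same ball T f - id is
contracting, so at each of its points the derivative [l0] of [f] satisfies
|T l0 v - v| <= |v| / 2 and is invertible by [near_identity_linear]; this makes
the inverse strictly differentiable on all of its domain, not only at f p. *)
Theorem inverse_function (f : V -> V) p l T (O : set V) :
  strict_diff f p l -> bounded_linear T -> cancel l T -> cancel T l ->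
  nbhs p O -> (forall x, O x -> strictly_diff f x) ->
  exists (U A : set V) (g : V -> V),
    [/\ open U, open A, U p, U `<=` O & set_bij U A f] /\
    [/\ forall x, U x -> g (f x) = x, forall y, A y -> U (g y),
        forall y, A y -> f (g y) = y & forall y, A y -> strictly_diff g y].
Proof.
move=> [bl fl] bT lT Tl pO fO; have [_ [k k0 Tk]] := bT.
have e0 : 0 < 4^-1 / k by rewrite divr_gt0// invr_gt0.
have [B pB Bf] := fl _ e0.
have /nbhs_distP[r r0 rOB] : nbhs p (O `&` B) by exact: filterI.
have rO x : `|x - p| < r -> O x by move=> /rOB[].
have GL x y : `|x - p| < r -> `|y - p| < r ->
    `|T (f x) - T (f y) - (x - y)| <= 4^-1 * `|x - y|.
  move=> /rOB[_ Bx] /rOB[_ By].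
  rewrite -{1}(lT (x - y)) -!(bounded_linearB _ _ bT) (le_trans (Tk _))//.
  rewrite -ler_pdivlMl// (le_trans (Bf _ _ Bx By))//.
  by rewrite mulrA [k^-1 * _]mulrC.
have q2 : 4^-1 <= 2^-1 :> C R by rewrite lef_pV2 ?posrE// ler_nat.
have lower x y : `|x - p| < r -> `|y - p| < r -> `|x - y| <= 2 * `|T (f x) - T (f y)|.
  move=> xr yr; rewrite -ler_pdivrMl//.
  have : `|x - y| - `|T (f x) - T (f y)| <= 2^-1 * `|x - y|.
    rewrite (le_trans (lerB_dist _ _))// distrC (le_trans (GL _ _ xr yr))//.
    by rewrite ler_wpM2r.
  rewrite lerBlDl -lerBlDr; congr (_ <= _).
  by field.
have lowerf x y : `|x - p| < r -> `|y - p| < r -> `|x - y| <= 2 * k * `|f x - f y|.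
  move=> xr yr; rewrite (le_trans (lower _ _ xr yr))// -mulrA ler_wpM2l//.
  by rewrite -(bounded_linearB _ _ bT).
have r4 : 0 < r / 4 by rewrite divr_gt0.
pose A := [set y | `|T y - T (f p)| < r / 8].
pose U := [set x | `|x - p| < r] `&` f @^-1` A.
have openA : open A.
  rewrite openE => y /= Ay; apply/nbhs_distP.
  exists ((r / 8 - `|T y - T (f p)|) / k); first by rewrite divr_gt0// subr_gt0.
  move=> z; rewrite ltr_pdivlMr// => zy; rewrite /A /= -(subrKA (T y)).
  rewrite (le_lt_trans (ler_normD _ _))// -ltrBrDr (le_lt_trans _ zy)//.
  by rewrite -(bounded_linearB _ _ bT) mulrC.
have surj y : A y -> exists x, U x /\ f x = y.
  rewrite /A /= => Ay.
  have r42 : 2 * (r / 4) < r.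
    have -> : 2 * (r / 4) = r / 2 by field.
    by rewrite ltr_pdivrMr// ltr_pMr// ltr1n.
  have [x1 y1 /le_lt_trans/(_ r42) x1r /le_lt_trans/(_ r42) y1r||x xp Gx] :=
      near_identity_surj (G := T \o f) (p := p) (z := T y) r4.
  - by rewrite (le_trans (GL _ _ x1r y1r))// ler_wpM2r.
  - have -> : r / 4 / 2 = r / 8 by field.
    exact: ltW.
  - have fx : f x = y by exact: (can_inj Tl).
    exists x; split=> //; split=> /=; first exact: le_lt_trans xp r42.
    by rewrite /A /= fx.
pose g y := xget p [set x | U x /\ f x = y].
have gP y : A y -> U (g y) /\ f (g y) = y.
  by move=> /surj; exact: xgetPex.
have inj x y : U x -> U y -> f x = f y -> x = y.
  move=> [xr _] [yr _] fxy; apply/eqP; rewrite -subr_eq0 -normr_le0.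
  by rewrite (le_trans (lowerf _ _ xr yr))// fxy subrr normr0 mulr0.
have Up : U p.
  by split=> /=; rewrite /A /= subrr normr0 ?divr_gt0.
have ballU x : `|x - p| < r -> nbhs x [set z | `|z - p| < r].
  move=> xr; apply/nbhs_distP; exists (r - `|x - p|); first by rewrite subr_gt0.
  move=> z; rewrite ltrBrDr /= => zx; rewrite -(subrKA x).
  exact: le_lt_trans (ler_normD _ _) zx.
have strictg y : A y -> strictly_diff g y.
  move=> Ay; have [[gyr fgyA] fgy] := gP _ Ay.
  have [l0 sl0] := fO _ (rO _ gyr); have [bl0 l0f] := sl0.
  have Tl0 v : `|T (l0 v) - v| <= 2^-1 * `|v|.
    have [D yD Dl0] := l0f _ e0.
    have /filterI /(_ (ballU _ gyr)) /nbhs_distP[s s0 sD] := yD.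
    (* l0 v is read off at the scale c, small enough for c v to stay in the ball. *)
    pose c := s / (`|v| + 1).
    have c0 : 0 < c by rewrite divr_gt0// ltr_wpDl.
    have [Dv vr] : (D `&` [set z | `|z - p| < r]) (g y + c *: v).
      apply: sD; rewrite addrAC subrr add0r normrZ gtr0_norm//.
      rewrite /c mulrAC ltr_pdivrMr ?ltr_wpDl// ltr_pM2l//.
      by rewrite ltrDl.
    have cv : g y + c *: v - g y = c *: v by rewrite addrAC subrr add0r.
    have := GL _ _ vr gyr; have := Dl0 _ _ Dv (nbhs_singleton yD); rewrite cv => h1 h2.
    rewrite -(ler_pM2l c0) -{1}(gtr0_norm c0) -normrZ scalerBr.
    rewrite -(bounded_linearZ _ _ bT) -(bounded_linearZ _ _ bl0).
    rewrite -(subrKA (T (f (g y + c *: v) - f (g y)))).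
    have -> : c * (2^-1 * `|v|) = 4^-1 * `|c *: v| + 4^-1 * `|c *: v|.
      by rewrite normrZ gtr0_norm//; field.
    rewrite (le_trans (ler_normD _ _))// lerD//; last by rewrite (bounded_linearB _ _ bT).
    rewrite -(bounded_linearB _ _ bT) (le_trans (Tk _))// -ler_pdivlMl// distrC.
    by rewrite (le_trans h1)// mulrA [k^-1 * _]mulrC.
  have [m' bm' [mK _]] := near_identity_linear (bounded_linear_comp bl0 bT) Tl0.
  exists (m' \o T).
  apply: (strict_diff_inverse (k := 2 * k) (A := A) sl0) => //.
  - exact: bounded_linear_comp.
  - exact: open_nbhs_nbhs.
  - by move=> z /gP[].
  - by rewrite mulr_gt0.
  - move=> z z' /gP[[zr _] fz] /gP[[z'r _] fz'].
    by rewrite -{2}fz -{2}fz'; exact: lowerf.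
exists U, A, g; split; split => //.
- rewrite openE => x [xr Ax]; apply: filterI; first exact: ballU.
  have [l0 sl0] := fO _ (rO _ xr).
  by apply: strict_diff_nbhs sl0 _; exact: open_nbhs_nbhs.
- by move=> x [/rO].
- split; first by move=> x [].
    by move=> x y; rewrite !inE; exact: inj.
  by move=> y /gP[Ugy fgy]; exists (g y).
- move=> x Ux; have [_ Ax] := Ux; have [Ugy fgy] := gP _ Ax.
  exact: inj.
- by move=> y /gP[].
- by move=> y /gP[].
Qed.

End InverseFunction.

Lemma scalar_inverse (R : realType) (P : C R -> C R) (z a : C R) (O : set (C R)) :
  a != 0 -> strict_diff P z (fun v => a * v) -> nbhs z O ->
  (forall x, O x -> strictly_diff P x) ->
  exists (A : set (C R)) (g : C R -> C R),
    [/\ open A, A (P z), g (P z) = z &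
        forall y, A y -> [/\ O (g y), P (g y) = y & strictly_diff g y]].
Proof.
move=> a0 dP zO dO.
have bT : bounded_linear (fun v : C R => a^-1 *: v).
  exact: bounded_linear_scale (bounded_linear_id _).
have [||U [A [g [[oU oA Uz UO UA] [gK Ug fK dg]]]]] :=
    inverse_function dP bT _ _ zO dO.
- by move=> v; rewrite /= /GRing.scale/= mulKf.
- by move=> v; rewrite /= /GRing.scale/= mulVKf.
exists A, g; split=> //; first by case: UA => + _ _; exact.
  exact: gK.
by move=> y Ay; split; [exact/UO/Ug|exact: fK|exact: dg].
Qed.

(** * The plane curve *)

Section Algebra.
Context {K : numFieldType}.
Variables (t : K).
Implicit Types k w v : K.

(** [branchL] is L, the equation of the smooth branch, and [cuspW] is W, the
coordinate in which the remaining quadratic factor is W^2 + E v^5 with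
E = 3 (k + t) / (4 k^6).  Moreover L - W = v * [slope] and [coefF] is
E / [slope]^5.  All of them are rational in k, w and v; later k becomes a
function of v. *)
Definition branchL k w v := w + v * k ^+ 2.
Definition cuspW k w v := w - v * ((k ^+ 2 - 9 * t ^+ 2) / 2).
Definition slope k := (3 * k ^+ 2 - 9 * t ^+ 2) / 2.
Definition coefF k := 3 * (k + t) / (4 * k ^+ 6 * slope k ^+ 5).
(** [coefA] collects the terms of degree at least 2 in W of W^2 + F (L - W)^5,
divided by W^2; the terms of degree 1 and 0 in W are - 5 F L^4 W and F L^5.
Completing the square turns them into [cuspX] and [coefC]. *)
Definition coefA k w v := let L := branchL k w v in let W := cuspW k w v in
  1 + coefF k * (10 * L ^+ 3 - 10 * L ^+ 2 * W + 5 * L * W ^+ 2 - W ^+ 3).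
Definition coefC k w v := coefF k - 25 * coefF k ^+ 2 * branchL k w v ^+ 3 / (4 * coefA k w v).
Definition cuspX k w v :=
  cuspW k w v - 5 * coefF k / (2 * coefA k w v) * branchL k w v ^+ 3 * branchL k w v.

Lemma plane_factor k w v : v = k ^+ 2 * (k - 3 * t) -> k != 0 -> slope k != 0 ->
  w ^+ 3 + v * (3 * t * w - v ^+ 2) ^+ 2 =
  branchL k w v * (cuspW k w v ^+ 2 + coefF k * (branchL k w v - cuspW k w v) ^+ 5).
Proof.
move=> vE k0 s0.
have -> : branchL k w v - cuspW k w v = v * slope k by rewrite /branchL /cuspW /slope; field.
have -> : coefF k * (v * slope k) ^+ 5 = 3 * (k + t) / (4 * k ^+ 6) * v ^+ 5.
  by rewrite /coefF; field; rewrite k0 s0.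
by rewrite /branchL /cuspW vE; field.
Qed.

Lemma complete_square (L W F A : K) : A != 0 ->
  A = 1 + F * (10 * L ^+ 3 - 10 * L ^+ 2 * W + 5 * L * W ^+ 2 - W ^+ 3) ->
  W ^+ 2 + F * (L - W) ^+ 5 =
  A * (W - 5 * F / (2 * A) * L ^+ 3 * L) ^+ 2
  + (F - 25 * F ^+ 2 * L ^+ 3 / (4 * A)) * L ^+ 5.
Proof.
move=> A0 AE.
have -> : W ^+ 2 + F * (L - W) ^+ 5 = A * W ^+ 2 - 5 * F * L ^+ 4 * W + F * L ^+ 5.
  by rewrite AE; ring.
by field.
Qed.
End Algebra.

(** The last equation gives s = 0 or s = 4 v^2.  The first case is immediate.
In the second 3 t w = 5 v^2, and eliminating w between the two other equations
leaves a nonzero multiple of v^5. *)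
Lemma plane_singular (K : numFieldType) (t w v : K) : t != 0 ->
  let s := 3 * t * w - v ^+ 2 in
  w ^+ 3 + v * s ^+ 2 = 0 -> 3 * w ^+ 2 + 6 * t * v * s = 0 ->
  s ^+ 2 - 4 * v ^+ 2 * s = 0 -> w = 0 /\ v = 0.
Proof.
move=> t0 s e0 e1 e2.
have n3 : 3 != 0 :> K by rewrite pnatr_eq0.
have := e2; rewrite expr2 -mulrBl => /eqP; rewrite mulf_eq0 orbC => /orP[/eqP s0|].
  have w0 : w = 0.
    move: e1; rewrite s0 mulr0 addr0 => /eqP.
    by rewrite mulf_eq0 (negbTE n3)/= expf_eq0/= => /eqP.
  split=> //; move: s0; rewrite /s w0 mulr0 sub0r => /eqP.
  by rewrite oppr_eq0 expf_eq0/= => /eqP.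
rewrite subr_eq0 => /eqP sE.
have tw : 3 * t * w = 5 * v ^+ 2 by rewrite -[LHS](subrK (v ^+ 2)) -/s sE; ring.
rewrite sE in e0 e1.
have v5 : 24 * v ^+ 5 = 0.
  have -> : 24 * v ^+ 5 = 9 * (w ^+ 3 + v * (4 * v ^+ 2) ^+ 2)
      - 3 * w * (3 * w ^+ 2 + 6 * t * v * (4 * v ^+ 2))
      + 24 * v ^+ 3 * (3 * t * w - 5 * v ^+ 2) by ring.
  by rewrite e0 e1 tw; ring.
have v0 : v = 0.
  by move/eqP: v5; rewrite mulf_eq0 pnatr_eq0 expf_eq0/= => /eqP.
split=> //; move/eqP: tw; rewrite v0 expr0n/= mulr0 !mulf_eq0 (negbTE n3) (negbTE t0)/=.
by move/eqP.
Qed.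

(** At k = 3 t the polynomial k^2 (k - 3 t) vanishes with derivative 9 t^2. *)
Lemma smooth_branch_parameter (R : realType) (t : C R) : t != 0 ->
  exists (A : set (C R)) (g : C R -> C R),
  [/\ open A, A 0, g 0 = 3 * t &
    forall y, A y -> [/\ g y != 0, slope t (g y) != 0,
      g y ^+ 2 * (g y - 3 * t) = y & strictly_diff g y]].
Proof.
move=> t0; pose P (z : C R) := z ^+ 2 * (z - 3 * t).
have sid (z : C R) : strict_diff (fun z : C R => z) z idfun.
  exact: strict_diff_linear (bounded_linear_id _).
have sP z := strict_diffM (strict_diffX 2 (sid z))
  (strict_diffB (sid z) (strict_diff_cst (3 * t) z)).
have P3 : P (3 * t) = 0 by rewrite /P subrr mulr0.
have s3 : slope t (3 * t) != 0.
  have -> : slope t (3 * t) = 9 * t ^+ 2 by rewrite /slope; field.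
  by rewrite mulf_neq0 ?expf_neq0// pnatr_eq0.
have sslope z : strictly_diff (slope t) z.
  apply: strictly_diffM; last exact: strictly_diff_cst.
  apply: strictly_diffD; last exact: strictly_diff_cst.
  apply: strictly_diffM; first exact: strictly_diff_cst.
  by eexists; exact: strict_diffX (sid z).
have [||||A [g [oA AP gP gA]]] := @scalar_inverse R P (3 * t) (9 * t ^+ 2)
   ([set z | z != 0] `&` [set z | slope t z != 0]).
- by rewrite mulf_neq0 ?expf_neq0// pnatr_eq0.
- by apply: strict_diff_eq (sP (3 * t)) _ _ => // z /=; ring.
- apply: filterI; first by apply: nbhs_neq0; rewrite mulf_neq0// pnatr_eq0.
  exact: strictly_diff_nbhs (sslope _) (nbhs_neq0 s3).
- by move=> z _; eexists; exact: sP.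
exists A, g; rewrite -[X in A X]P3 -[X in g X = _]P3; split=> // y /gA[[? ?] ? ?].
by split.
Qed.

Lemma square_root (R : realType) (c : C R) : c != 0 ->
  exists (A : set (C R)) (g : C R -> C R),
  [/\ open A, A c & forall y, A y -> [/\ g y != 0, g y ^+ 2 = y & strictly_diff g y]].
Proof.
move=> c0.
have sid (z : C R) : strict_diff (fun z : C R => z) z idfun.
  exact: strict_diff_linear (bounded_linear_id _).
have s0 : sqrtC c != 0 by rewrite sqrtC_eq0.
have [||||A [g [oA AP gP gA]]] := @scalar_inverse R (fun z => z ^+ 2) (sqrtC c)
   (2 * sqrtC c) [set z | z != 0].
- by rewrite mulf_neq0// pnatr_eq0.
- by apply: strict_diff_eq (strict_diffX 2 (sid _)) _ _ => // z /=; rewrite expr1.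
- exact: nbhs_neq0.
- by move=> z _; eexists; exact: strict_diffX (sid z).
exists A, g; rewrite sqrtCK in AP; split=> // y /gA[].
Qed.

(** * The family *)

Section Family.
Variables (R : realType) (N : nat).
Hypothesis hN : (1 <= N)%N.
Variable t : C R.
Hypothesis t0 : t != 0.
Local Notation E := 'rV[C R]_N.+1.
Implicit Types x : E.

Let iN : 'I_N.+1 := inord N.-1.
Let iL : 'I_N.+1 := inord N.

Let vv x : C R := crd x N.+1.
Let ww x : C R := crd x N - 3 * t ^+ 2 * crd x N.+1.

Lemma iN_neq_iL : iL != iN.
Proof.
by apply/eqP => /(congr1 val); rewrite /= !inordK; move: hN; lia.
Qed.

Lemma inord_neq (i : nat) : (1 <= i < N)%N ->
  ((inord i.-1 == iN :> 'I_N.+1) = false) * ((inord i.-1 == iL :> 'I_N.+1) = false).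
Proof.
by move=> iN'; split; apply/eqP => /(congr1 val); rewrite /= !inordK; lia.
Qed.

(** The cubic part of f_t is (x_N - 3 t^2 x_(N+1))^2 (x_N + 6 t^2 x_(N+1)), which
suggests w; in terms of w what remains besides w^3 is v times a perfect
square. *)
Lemma ft_plane x : ft t x =
  \sum_(1 <= i < N) crd x i ^+ 2 +
  (ww x ^+ 3 + vv x * (3 * t * ww x - vv x ^+ 2) ^+ 2).
Proof. by rewrite /ft /f0 /ww /vv; ring. Qed.

Lemma bounded_linear_crd k : bounded_linear (fun x => crd x k).
Proof. exact: bounded_linear_coord. Qed.

Lemma bounded_linear_ww : bounded_linear ww.
Proof.
have := bounded_linear_add (bounded_linear_crd N)
  (bounded_linear_scale (- (3 * t ^+ 2)) (bounded_linear_crd N.+1)).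
by apply: bounded_linear_eq => x; rewrite /ww /GRing.scale/=; ring.
Qed.

Lemma bounded_linear_vv : bounded_linear vv.
Proof. exact: bounded_linear_crd. Qed.

Lemma crd0 k : crd (0 : E) k = 0. Proof. by rewrite /crd mxE. Qed.
Lemma ww0 : ww 0 = 0. Proof. by rewrite /ww !crd0; ring. Qed.
Lemma vv0 : vv 0 = 0. Proof. by rewrite /vv crd0. Qed.

Lemma strictly_diff_ww x : strictly_diff ww x.
Proof. by exists ww; exact/strict_diff_linear/bounded_linear_ww. Qed.
Lemma strictly_diff_vv x : strictly_diff vv x.
Proof. by exists vv; exact/strict_diff_linear/bounded_linear_vv. Qed.

(** The change of coordinates sends x_N to X, x_(N+1) to Y and rescales the other
coordinates.  Its derivative at the origin is triangular in w and v: X has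
derivative (C / A)^2 w and Y has derivative (C / A) (w + 9 t^2 v), because X0 - w
and L - w - 9 t^2 v have no linear term. *)
Lemma germ_equivalent_ft : germ_equivalent (ft t) 0 (@D_normal_form R N 7) 0.
Proof.
have [A1 [g [oA1 A1_0 g0 gA1]]] := smooth_branch_parameter t0.
pose k x := g (vv x).
pose f_L x := branchL (k x) (ww x) (vv x).
pose f_W x := cuspW t (k x) (ww x) (vv x).
pose f_F x := coefF t (k x).
pose f_A x := coefA t (k x) (ww x) (vv x).
pose f_C x := coefC t (k x) (ww x) (vv x).
pose D1 := [set x | A1 (vv x)].
have n4 : 4 != 0 :> C R by rewrite pnatr_eq0.
have k_sd x : D1 x -> strictly_diff k x.
  by move=> D1x; apply: strictly_diff_comp (strictly_diff_vv x) _; case: (gA1 _ D1x).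
have L_sd x : D1 x -> strictly_diff f_L x.
  move=> D1x; apply: strictly_diffD (strictly_diff_ww x) _.
  exact: strictly_diffM (strictly_diff_vv x) (strictly_diffX 2 (k_sd x D1x)).
have k2_sd x c d : D1 x -> strictly_diff (fun x => (c * k x ^+ 2 - d) / 2) x.
  move=> D1x; apply: strictly_diffM; last exact: strictly_diff_cst.
  apply: strictly_diffD; last exact: strictly_diff_cst.
  apply: strictly_diffM; first exact: strictly_diff_cst.
  exact: strictly_diffX (k_sd x D1x).
have W_sd x : D1 x -> strictly_diff f_W x.
  move=> D1x; apply: strictly_diffD (strictly_diff_ww x) _.
  apply/strictly_diffN/(strictly_diffM (strictly_diff_vv x)).
  have := k2_sd x 1 (9 * t ^+ 2) D1x; congr strictly_diff.
  by apply/funext => y; rewrite mul1r.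
have F_sd x : D1 x -> strictly_diff f_F x.
  move=> D1x; have [k0 s0 _ _] := gA1 _ D1x.
  apply: strictly_diffM.
    apply: strictly_diffM (strictly_diff_cst _ _) _.
    exact: strictly_diffD (k_sd x D1x) (strictly_diff_cst _ _).
  apply: strictly_diffV.
    exact: mulf_neq0 (mulf_neq0 n4 (expf_neq0 _ k0)) (expf_neq0 _ s0).
  apply: strictly_diffM.
    exact: strictly_diffM (strictly_diff_cst _ _) (strictly_diffX 6 (k_sd x D1x)).
  by apply: strictly_diffX; exact: k2_sd.
have A_sd x : D1 x -> strictly_diff f_A x.
  move=> D1x; have sL := L_sd x D1x; have sW := W_sd x D1x.
  have sc (c : C R) := strictly_diff_cst c x.
  apply: strictly_diffD (sc _) _; apply: strictly_diffM (F_sd x D1x) _.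
  apply: strictly_diffD; last exact/strictly_diffN/strictly_diffX.
  apply: strictly_diffD; last first.
    exact: strictly_diffM (strictly_diffM (sc _) sL) (strictly_diffX 2 sW).
  apply: strictly_diffD; first exact: strictly_diffM (sc _) (strictly_diffX 3 sL).
  apply: strictly_diffN.
  exact: strictly_diffM (strictly_diffM (sc _) (strictly_diffX 2 sL)) sW.
have C_sd x : D1 x -> f_A x != 0 -> strictly_diff f_C x.
  move=> D1x A0; have sL := L_sd x D1x; have sF := F_sd x D1x.
  have sc (c : C R) := strictly_diff_cst c x.
  apply: (strictly_diffD sF); apply: strictly_diffN.
  apply: strictly_diffM.
    exact: strictly_diffM (strictly_diffM (sc _) (strictly_diffX 2 sF)) (strictly_diffX 3 sL).
  apply: strictly_diffV; first by rewrite mulf_neq0// pnatr_eq0.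
  exact: strictly_diffM (sc _) (A_sd x D1x).
have D10 : D1 0 by rewrite /D1 /= vv0.
have k00 : k 0 = 3 * t by rewrite /k vv0.
have L0 : f_L 0 = 0 by rewrite /f_L /branchL ww0 vv0 mul0r addr0.
have W0 : f_W 0 = 0 by rewrite /f_W /cuspW ww0 vv0 mul0r subr0.
have F0 : f_F 0 != 0.
  have [k0 s0 _ _] := gA1 _ D10; rewrite /f_F /coefF mulf_neq0 ?invr_neq0//.
    rewrite mulf_neq0 ?pnatr_eq0// -/(k 0) k00 (_ : _ + _ = 4 * t); last by ring.
    by rewrite mulf_neq0 ?pnatr_eq0.
  exact: mulf_neq0 (mulf_neq0 n4 (expf_neq0 _ k0)) (expf_neq0 _ s0).
have A00 : f_A 0 = 1.
  by rewrite /f_A /coefA -/(f_L 0) -/(f_W 0) L0 W0 -/(f_F 0); ring.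
have C00 : f_C 0 = f_F 0.
  by rewrite /f_C /coefC -/(f_L 0) L0 expr0n/= mulr0 mul0r subr0.
have [A2 [sq [oA2 A2C sqA]]] := square_root F0.
(* The successive domains: k is defined on D1, A is invertible on D2, and C has
   an invertible holomorphic square root on O. *)
pose D2 := D1 `&` [set x | f_A x != 0].
pose O := D2 `&` [set x | f_C x != 0 /\ A2 (f_C x)].
have nD1 : nbhs (0 : E) D1.
  apply: strictly_diff_nbhs (strictly_diff_vv 0) _.
  by rewrite vv0; exact: open_nbhs_nbhs.
have nD2 : nbhs (0 : E) D2.
  apply: filterI => //; apply: (strictly_diff_nbhs (A := [set z | z != 0]) (A_sd _ D10)).
  by apply: nbhs_neq0; rewrite A00 oner_neq0.
have nO : nbhs (0 : E) O.
  apply: filterI => //.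
  have sC : strictly_diff f_C 0 by apply: C_sd => //; rewrite A00 oner_neq0.
  apply: (strictly_diff_nbhs (A := [set y | y != 0 /\ A2 y]) sC); rewrite C00.
  by apply: filterI; [exact: nbhs_neq0|exact: open_nbhs_nbhs].
pose rho x := sq (f_C x) * f_C x ^+ 2 / f_A x ^+ 3.
pose X x := (f_C x / f_A x) ^+ 2 * cuspX t (k x) (ww x) (vv x).
pose Y x := f_C x / f_A x * f_L x.
pose comp (j : 'I_N.+1) x :=
  if j == iN then X x else if j == iL then Y x else rho x * x 0 j.
pose phi x : E := \row_j comp j x.
have CA_sd x : O x -> strictly_diff (fun x => f_C x / f_A x) x.
  move=> [[D1x A0] _]; apply: strictly_diffM; first exact: C_sd.
  by apply: strictly_diffV => //; exact: A_sd.
have rho_sd x : O x -> strictly_diff rho x.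
  move=> [[D1x A0] [C0 A2x]]; have sC := C_sd x D1x A0.
  apply: strictly_diffM; last first.
    by apply: strictly_diffV; [rewrite expf_neq0|apply/strictly_diffX/A_sd].
  apply: strictly_diffM (strictly_diffX 2 sC).
  by apply: (strictly_diff_comp sC); case: (sqA _ A2x).
have c_sd x : O x -> strictly_diff (fun x => 5 * f_F x / (2 * f_A x) * f_L x ^+ 3) x.
  move=> [[D1x A0] _]; have sc (c : C R) := strictly_diff_cst c x.
  apply: strictly_diffM; last by apply/strictly_diffX/L_sd.
  apply: strictly_diffM; first by apply: strictly_diffM (sc _) _; exact: F_sd.
  apply: strictly_diffV; first by rewrite mulf_neq0// pnatr_eq0.
  by apply: strictly_diffM (sc _) _; exact: A_sd.
have comp_sd j x : O x -> strictly_diff (comp j) x.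
  move=> Ox; have [[D1x A0] _] := Ox; rewrite /comp.
  case: (j == iN).
    apply: strictly_diffM (strictly_diffX 2 (CA_sd x Ox)) _.
    apply: strictly_diffD (W_sd x D1x) _; apply: strictly_diffN.
    exact: strictly_diffM (c_sd x Ox) (L_sd x D1x).
  case: (j == iL); first exact: strictly_diffM (CA_sd x Ox) (L_sd x D1x).
  apply: strictly_diffM (rho_sd x Ox) _.
  exists (fun x => x 0 j); exact/strict_diff_linear/bounded_linear_coord.
have phi_sd x : O x -> strictly_diff phi x.
  by move=> Ox; apply: strictly_diff_row => j; exact: comp_sd.
have O_0 : O 0 by exact: nbhs_singleton nO.
pose c0 := f_C 0 / f_A 0; pose r0 := rho 0.
have c0_neq0 : c0 != 0 by rewrite /c0 A00 divr1 C00.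
have r0_neq0 : r0 != 0.
  have [_ [C0 A2_0]] := O_0; have [sq0 _ _] := sqA _ A2_0.
  by rewrite /r0 /rho A00 expr1n divr1 mulf_neq0// expf_neq0.
have dv := strict_diff_linear 0 bounded_linear_vv.
have dw := strict_diff_linear 0 bounded_linear_ww.
have dL : strict_diff f_L 0 (fun z => ww z + 9 * t ^+ 2 * vv z).
  have := strict_diffD dw (strict_diffMv (strictly_diffX 2 (k_sd 0 D10)) vv0 dv).
  move/strict_diff_eq; apply=> z; first by rewrite /f_L /branchL [vv z * _]mulrC.
  by rewrite k00; ring.
have dW : strict_diff f_W 0 ww.
  have := strict_diffB dw (strict_diffMv (k2_sd 0 1 (9 * t ^+ 2) D10) vv0 dv).
  move/strict_diff_eq; apply=> z; first by rewrite /f_W /cuspW mul1r [vv z * _]mulrC.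
  by rewrite k00; field.
have dX0 : strict_diff (fun x => cuspX t (k x) (ww x) (vv x)) 0 ww.
  have := strict_diffB dW (strict_diffMv (c_sd 0 O_0) L0 dL).
  move/strict_diff_eq; apply=> z; first by [].
  by rewrite L0 expr0n/=; ring.
have X0_0 : cuspX t (k 0) (ww 0) (vv 0) = 0.
  by rewrite /cuspX -/(f_L 0) -/(f_W 0) L0 W0; ring.
have dX := strict_diffMv (strictly_diffX 2 (CA_sd 0 O_0)) X0_0 dX0.
have dY := strict_diffMv (CA_sd 0 O_0) L0 dL.
pose l z : E := \row_j (if j == iN then c0 ^+ 2 * ww z
  else if j == iL then c0 * (ww z + 9 * t ^+ 2 * vv z) else r0 * z 0 j).
have dphi : strict_diff phi 0 l.
  apply: strict_diff_row => j; rewrite /comp.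
  case: (j == iN); first exact: dX.
  case: (j == iL); first exact: dY.
  apply: (strict_diffMv (rho_sd 0 O_0)); first by rewrite mxE.
  exact/strict_diff_linear/bounded_linear_coord.
(* The inverse of l: a and b recover w and v from the coordinates X and Y. *)
pose a z : C R := (c0 ^+ 2)^-1 *: (z : E) 0 iN.
pose b z : C R := (9 * t ^+ 2)^-1 *: (c0^-1 *: (z : E) 0 iL + (-1) *: a z).
pose T z : E := \row_j (if j == iN then a z + (3 * t ^+ 2) *: b z
  else if j == iL then b z else r0^-1 *: z 0 j).
have bc j := @bounded_linear_coord (C R) N.+1 j.
have bT : bounded_linear T.
  have ba : bounded_linear a by exact: bounded_linear_scale (bc _).
  have bb : bounded_linear b.
    apply: bounded_linear_scale; apply: bounded_linear_add.
      exact: bounded_linear_scale (bc _).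
    exact: bounded_linear_scale ba.
  apply: bounded_linear_row => j.
  case: (j == iN).
    exact: bounded_linear_add ba (bounded_linear_scale _ bb).
  case: (j == iL); first exact: bb.
  exact: bounded_linear_scale (bc _).
have n3 : 3 != 0 :> C R by rewrite pnatr_eq0.
have lT : cancel l T.
  move=> z; apply/rowP => j; rewrite mxE /b /a /GRing.scale/= !mxE !eqxx.
  rewrite (negbTE iN_neq_iL); case: eqP => [->|_]; last case: eqP => [->|_].
  - rewrite /ww /vv /crd -/iN -/iL. by field; rewrite t0 c0_neq0.
  - rewrite /ww /vv /crd -/iN -/iL. by field; rewrite t0 c0_neq0.
  - by rewrite mulKf.
have Tl : cancel T l.
  move=> z; apply/rowP => j; rewrite mxE.
  have wT : ww (T z) = a z.
    by rewrite /ww /crd !mxE -/iN -/iL !eqxx (negbTE iN_neq_iL)/= /GRing.scale/= addrK.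
  have vT : vv (T z) = b z.
    by rewrite /vv /crd !mxE -/iN -/iL !eqxx (negbTE iN_neq_iL).
  rewrite wT vT !mxE; case: eqP => [->|_]; last case: eqP => [->|_].
  - by rewrite /a /GRing.scale/= mulVKf// expf_neq0.
  - by rewrite /b /a /GRing.scale/=; field; rewrite t0 c0_neq0.
  - by rewrite /GRing.scale/= mulVKf.
have [U [V [psi [[oU oV U0 UO bij] [psiK _ _ psi_sd]]]]] :=
  inverse_function dphi bT lT Tl nO phi_sd.
have phi0 : phi 0 = 0.
  apply/rowP => j; rewrite !mxE /comp.
  case: (j == iN); first by rewrite /X X0_0 mulr0.
  by case: (j == iL); [rewrite /Y L0 mulr0|rewrite mxE mulr0].
exists U, V, phi, (fun x => f_A x ^+ 6 / f_C x ^+ 5); split.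
- split=> //.
    by move=> x /UO/phi_sd/strictly_diff_differentiable.
  by exists psi; split=> // y /psi_sd/strictly_diff_differentiable.
- by [].
- move=> x /UO Ox; have [[D1x A0] [C0 _]] := Ox.
  apply: strictly_diff_differentiable.
  apply: strictly_diffM; first by apply/strictly_diffX/A_sd.
  by apply: strictly_diffV; [rewrite expf_neq0|apply/strictly_diffX/C_sd].
- move=> x /UO[[_ A0] [C0 _]].
  by rewrite mulf_neq0 ?invr_neq0 ?expf_neq0.
move=> x /UO[[D1x A0] [C0 A2x]].
have [k0 s0 kv _] := gA1 _ D1x; have [_ sq2 _] := sqA _ A2x.
have vE : vv x = k x ^+ 2 * (k x - 3 * t) by [].
have phiN : crd (phi x) N = X x by rewrite /crd mxE /comp -/iN eqxx.
have phiL : crd (phi x) N.+1 = Y x.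
  by rewrite /crd mxE /comp -/iL (negbTE iN_neq_iL) eqxx.
have phii i : (1 <= i < N)%N -> crd (phi x) i ^+ 2 = rho x ^+ 2 * crd x i ^+ 2.
  by move=> iN'; rewrite /crd mxE /comp !(inord_neq iN') exprMn.
rewrite /D_normal_form phiN phiL (eq_big_nat _ _ phii) -mulr_sumr ft_plane.
rewrite (plane_factor (ww x) vE k0 s0) (complete_square A0 (erefl _)).
rewrite -/(coefC t (k x) (ww x) (vv x)) -/(f_C x) -/(f_L x) -/(f_A x).
rewrite /rho /X /Y.
have -> : (sq (f_C x) * f_C x ^+ 2 / f_A x ^+ 3) ^+ 2 = f_C x ^+ 5 / f_A x ^+ 6.
  have -> : (sq (f_C x) * f_C x ^+ 2 / f_A x ^+ 3) ^+ 2 =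
      sq (f_C x) ^+ 2 * f_C x ^+ 4 / f_A x ^+ 6 by field.
  by rewrite sq2 -exprS.
rewrite (_ : (7 - 1)%N = 6%N)//.
rewrite -/(f_F x) -/(f_W x).
set X0 := _ - _ * f_L x; rewrite -/X0.
have -> : cuspX t (k x) (ww x) (vv x) = X0 by [].
by field; rewrite A0 C0.
Qed.

Lemma singular_point_ft x : singular_point (ft t) x <-> x = 0.
Proof.
pose dsum (y z : E) : C R := \sum_(1 <= i < N) 2 * crd y i * crd z i.
pose s y := 3 * t * ww y - vv y ^+ 2.
have dft : strict_diff (ft t) x (fun z => dsum x z +
   ((3 * ww x ^+ 2 + 6 * t * vv x * s x) * ww z +
    (s x ^+ 2 - 4 * vv x ^+ 2 * s x) * vv z)).
  have dc i := strict_diff_linear x (bounded_linear_crd i).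
  have dw := strict_diff_linear x bounded_linear_ww.
  have dv := strict_diff_linear x bounded_linear_vv.
  have ds := strict_diffB (strict_diffM (strict_diff_cst (3 * t) x) dw) (strict_diffX 2 dv).
  have := strict_diffD (strict_diff_sum (index_iota 1 N) (fun i => strict_diffX 2 (dc i)))
    (strict_diffD (strict_diffX 3 dw) (strict_diffM dv (strict_diffX 2 ds))).
  move/strict_diff_eq; apply=> z; first by rewrite ft_plane.
  by rewrite /dsum /s /=; under eq_bigr do rewrite expr1; ring.
split; last first.
  move=> x0; split.
    rewrite ft_plane x0 ww0 vv0 big1_seq; first by ring.
    by move=> i _; rewrite crd0 expr0n.
  move=> i; apply: is_derive_eq (strict_diff_is_derive _ dft) _; rewrite x0 /dsum /s ww0 vv0 big1_seq; first by ring.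
  by move=> j _; rewrite crd0 mulr0 mul0r.
move=> [fx0 fx].
have D z : (exists i, z = delta_mx 0 i) -> dsum x z +
   ((3 * ww x ^+ 2 + 6 * t * vv x * s x) * ww z +
    (s x ^+ 2 - 4 * vv x ^+ 2 * s x) * vv z) = 0.
  move=> [i ->]; have [_ <-] := strict_diff_is_derive (delta_mx 0 i) dft.
  by have [_ ->] := fx i.
have xi i : (1 <= i < N)%N -> crd x i = 0.
  move=> iN'; have := D _ (ex_intro _ (inord i.-1) erefl).
  rewrite (_ : ww (delta_mx 0 _) = 0); last first.
    by rewrite /ww /crd !mxE -/iN -/iL ![_ == inord i.-1]eq_sym !(inord_neq iN') !andbF mulr0 subr0.
  rewrite (_ : vv (delta_mx 0 _) = 0); last first.
    by rewrite /vv /crd !mxE -/iL eq_sym (inord_neq iN') andbF.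
  rewrite !mulr0 !addr0 /dsum (bigD1_seq i) ?mem_index_iota ?iota_uniq//=.
  rewrite big1_seq ?addr0 => [|j /andP[ji]]; last first.
    rewrite mem_index_iota => jN; rewrite /crd !mxE.
    suff -> : (inord j.-1 == inord i.-1 :> 'I_N.+1) = false by rewrite mulr0.
    apply/eqP => /(congr1 val); rewrite /= !inordK; [|lia|lia].
    by move: ji => /eqP; lia.
  rewrite /crd !mxE !eqxx mulr1 => /eqP.
  by rewrite mulf_eq0 pnatr_eq0/= => /eqP.
have dsum0 j : j = iN \/ j = iL -> dsum x (delta_mx 0 j) = 0.
  move=> jE; rewrite /dsum big_nat big1// => i iN'; rewrite /crd !mxE.
  by case: jE => ->; rewrite (inord_neq iN')/= mulr0.
have e1 : 3 * ww x ^+ 2 + 6 * t * vv x * s x = 0.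
  have := D _ (ex_intro _ iN erefl); rewrite dsum0; last by left.
  rewrite (_ : ww (delta_mx 0 _) = 1); last first.
    by rewrite /ww /crd !mxE -/iN -/iL !eqxx (negbTE iN_neq_iL) mulr0 subr0.
  rewrite (_ : vv (delta_mx 0 _) = 0); last first.
    by rewrite /vv /crd !mxE -/iL !eqxx (negbTE iN_neq_iL).
  by rewrite mulr0 mulr1 addr0 add0r.
have e2 : s x ^+ 2 - 4 * vv x ^+ 2 * s x = 0.
  have := D _ (ex_intro _ iL erefl); rewrite e1 mul0r add0r dsum0; last by right.
  rewrite (_ : vv (delta_mx 0 _) = 1); last by rewrite /vv /crd !mxE -/iL !eqxx.
  by rewrite mulr1 add0r.
have e0 : ww x ^+ 3 + vv x * s x ^+ 2 = 0.
  move: fx0; rewrite ft_plane big_nat big1 ?add0r// => i iN'.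
  by rewrite xi// expr0n.
have [w0 v0] : ww x = 0 /\ vv x = 0 by exact: plane_singular t0 e0 e1 e2.
apply/rowP => j; rewrite mxE.
have [->|jN] := eqVneq j iN.
  by have := w0; rewrite /ww -/(vv x) v0 mulr0 subr0.
have [->|jL] := eqVneq j iL; first exact: v0.
have jlt : (1 <= j.+1 < N)%N.
  move: jN jL; rewrite -!val_eqE /= !inordK ?ltnS ?leq_pred//.
  by have := ltn_ord j; lia.
by have := xi _ jlt; rewrite /crd /= inord_val.
Qed.

End Family.

Local Close Scope complex_scope.
Local Close Scope classical_set_scope.

Theorem mainTheorem12 (R : realType) (N : nat) (hN : (1 <= N)%N) :
  generic (fun t : C R =>
    (forall x : 'rV[C R]_N.+1, singular_point (ft t) x <-> x = 0) /\
    type_D 7 (ft t) (0 : 'rV[C R]_N.+1)).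
Proof.
exists 'X; split=> [|t]; first by rewrite polyX_eq0.
rewrite hornerX => t0.
split; first exact: singular_point_ft.
split; [by []| |exact: germ_equivalent_ft].
split; first by apply/(singular_point_ft hN t0).
by apply: (@nearW _ (nbhs (0 : 'rV[C R]_N.+1))) => x /(singular_point_ft hN t0).
Qed.
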